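(* $\mathsf{QCDCL}^{\textsf{ASS-R-ORD}}_{\textsf{RED}}$ is exponentially stronger than $\mathsf{QCDCL}^{\textsf{LEV-ORD}}_{\textsf{RED}}$: the former p-simulates the latter, and there is a family of false QCNFs that have polynomial-size $\mathsf{QCDCL}^{\textsf{ASS-R-ORD}}_{\textsf{RED}}$ refutations but require exponential-size $\mathsf{QCDCL}^{\textsf{LEV-ORD}}_{\textsf{RED}}$ refutations.
   Context: QBF basics. A literal is a variable $x$ or $\bar x$; a clause is a disjunction of literals identified with its set of literals; $(\bot)$ is the empty clause. A QCNF is $\Phi=\mathcal{Q}\cdot\phi$ with prefix $\mathcal{Q}=Q_1X_1\dots Q_sX_s$ (disjoint nonempty variable sets, alternating $Q_i\in\{\exists,\forall\}$) and matrix $\phi$ a CNF of non-tautological clauses. $\mathrm{lv}(x)=i$ if the variable of $x$ is in $X_i$; existential/universal variables are those in $\exists$/$\forall$-blocks. $\mathrm{red}(C)$ deletes from $C$ every universal literal $v$ with $\mathrm{lv}(v)>\mathrm{lv}(x)$ for all existential $x\in C$. For existential $\ell$ not occurring (as variable) in $C_1,C_2$: $(C_1\vee\ell)\otimes_\ell(C_2\vee\bar\ell)=C_1\vee C_2$. QCDCL. $C|_\sigma=\top$ if $C\cap\sigma\neq\emptyset$, else the clause of all $\ell\in C$ with $\bar\ell\notin\sigma$. A trail for $\Phi=\mathcal{Q}\cdot\phi$ is $\mathcal{T}=(p_{(0,1)},\dots,p_{(0,g_0)};d_1,p_{(1,1)},\dots,p_{(1,g_1)};\dots;d_r,p_{(r,1)},\dots,p_{(r,g_r)})$,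 a sequence of literals with no variable occurring twice; $d_i$ decision literals, $p_{(i,j)}$ propagated literals (existential, or $\bot$ only as last element: a conflict). $\mathcal{T}[s,t]$: initial segment ending at $p_{(s,t)}$ (at $d_s$ if $t=0$; $\mathcal{T}[0,0]$ empty); $|\mathcal{T}|$: number of elements. Policy RED: each $p_{(i,j)}$ has an antecedent $\mathrm{ante}(p_{(i,j)})\in\phi$ with $\mathrm{red}(\mathrm{ante}(p_{(i,j)})|_{\mathcal{T}[i,j-1]})=(p_{(i,j)})$ ($(\bot)$ = empty clause). Decision policies: LEV-ORD: $\mathrm{lv}(d_i)\le\mathrm{lv}(x)$ for all variables $x$ of $\phi$ unassigned in $\mathcal{T}[i-1,g_{i-1}]$; ASS-R-ORD: an existential literal $x$ may be decided only if every universal variable $u$ with $\mathrm{lv}(u)<\mathrm{lv}(x)$ has already been decided earlier in the trail (universal decisions unrestricted). A clause $C$ is unit if $\mathrm{red}(C)=(x)$, $x$ existential, or $\mathrm{red}(C)$ empty ($x=\bot$). Natural condition at an initial segment without $\bot$: if some clauses of the current clause set are unit under it, the next element is the literal of one of them with that clause as antecedent, and is $\bot$ if possible; natural trail: holds everywhere. Learnable clauses of a trail ending in $\bot$: $C_{(r,g_r)}=\mathrm{red}(\mathrm{ante}(\bot))$; leftwards over propagated $p$, with $C'$ the clause of the next propagated literal to the right, the clause of $p$ is $\mathrm{red}(C'\otimes_p\mathrm{red}(\mathrm{ante}(p)))$ if $\bar p\in C'$, else $C'$; $\mathcal{L}_\mathcal{T}$ is this sequence. A $\mathsf{QCDCL}^{P}_{\textsf{RED}}$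 proof of $C$ from $\Phi$ is $((\mathcal{T}_1,\dots,\mathcal{T}_m),(C_1,\dots,C_m),(\pi_1,\dots,\pi_m))$: each $\mathcal{T}_i$ a trail following $P$ and RED for $\mathcal{Q}\cdot(\phi\cup\{C_1,\dots,C_{i-1}\})$ that has run into a conflict, $C_i\in\mathcal{L}_{\mathcal{T}_i}$ with its derivation $\pi_i$, $C_m=C$, $\mathcal{T}_1$ natural, and for $i\ge2$ some $(s,t)$ with $\mathcal{T}_i[s,t]=\mathcal{T}_{i-1}[s,t]$ such that $\mathcal{T}_i$ satisfies the natural condition at all initial segments extending $\mathcal{T}_i[s,t]$. Refutation if $C=(\bot)$; size $\sum_i|\mathcal{T}_i|$. A system $g$ p-simulates $f$ if every $f$-proof can be transformed in polynomial time into a $g$-proof of the same formula. *)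

(* Defs.v *)
From Corelib Require Import BinNums.
From mathcomp Require Import all_boot.

Set Implicit Arguments.
Unset Strict Implicit.
Unset Printing Implicit Defensive.

Definition var := nat.

Definition literal := (var * bool)%type.

Definition neg (l : literal) : literal := (l.1, ~~ l.2).

(* Clauses and CNFs are listed; a clause stands for its set of literals, so
   clauses are compared with [=i], never as lists. *)
Definition clause := seq literal.

Definition cnf := seq clause.

Definition quantifier := bool.
Definition qex : quantifier := true.
Definition qall : quantifier := false.

Definition quant_prefix := seq (quantifier * seq var).

Record qcnf := QCNF { qprefix : quant_prefix; qmatrix : cnf }.

Definition prefix_vars (Q : quant_prefix) : seq var :=
  flatten [seq b.2 | b <- Q].

Definition lv (Q : quant_prefix) (x : var) : nat :=
  (find (fun b : quantifier * seq var => x \in b.2) Q).+1.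

Definition quantified (q : quantifier) (Q : quant_prefix) (x : var) : bool :=
  has (fun b : quantifier * seq var => (b.1 == q) && (x \in b.2)) Q.

Definition existential := quantified qex.
Definition universal := quantified qall.

Definition tautological (C : clause) : bool := has (fun l => neg l \in C) C.

Definition qcnf_wf (Phi : qcnf) : Prop :=
  [/\ uniq (prefix_vars (qprefix Phi)),
      all (fun b : quantifier * seq var => b.2 != [::]) (qprefix Phi),
      sorted (fun b c : quantifier * seq var => b.1 != c.1) (qprefix Phi),
      all (all (fun l : literal => l.1 \in prefix_vars (qprefix Phi)))
          (qmatrix Phi)
    & all (fun C => ~~ tautological C) (qmatrix Phi)].

Definition assignment := var -> bool.

Definition update (a : assignment) (x : var) (v : bool) : assignment :=
  fun y => if y == x then v else a y.

Definition cnf_sat (a : assignment) (phi : cnf) : bool :=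
  all (has (fun l : literal => a l.1 == l.2)) phi.

Fixpoint qtrue_rec (Q : seq (quantifier * var)) (phi : cnf)
    (a : assignment) : bool :=
  match Q with
  | [::] => cnf_sat a phi
  | (q, x) :: Q' =>
      let t := qtrue_rec Q' phi (update a x true) in
      let f := qtrue_rec Q' phi (update a x false) in
      if q == qex then t || f else t && f
  end.

(* The initial assignment is irrelevant when [qcnf_wf Phi] holds, since then
   every variable of the matrix is quantified. *)
Definition qcnf_true (Phi : qcnf) : bool :=
  qtrue_rec (flatten [seq [seq (b.1, x) | x <- b.2] | b <- qprefix Phi])
            (qmatrix Phi) (fun=> false).

Definition red (Q : quant_prefix) (C : clause) : clause :=
  [seq l <- C | ~~ (universal Q l.1 &&
     all (fun x : literal => existential Q x.1 ==> (lv Q x.1 < lv Q l.1)) C)].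

(* For [p] in [D] and [neg p] in [C] this is the resolvent over the pivot [p].
   The side condition that the variable of [p] occurs in neither remainder is
   automatic for the clauses arising in clause learning from a trail. *)
Definition resolvent (p : literal) (C D : clause) : clause :=
  [seq l <- C | l != neg p] ++ [seq l <- D | l != p].

Inductive derivation :=
  | Ax of clause
  | Red of derivation
  | Res of literal & derivation & derivation.

Fixpoint concl (Q : quant_prefix) (d : derivation) : clause :=
  match d with
  | Ax C => C
  | Red d => red Q (concl Q d)
  | Res p d e => resolvent p (concl Q d) (concl Q e)
  end.

(* A propagated element carries its antecedent; its literal is [None] for a
   conflict. *)
Inductive element :=
  | Decided of literal
  | Propagated of option literal & clause.

(* The list [p_(0,1), ..., p_(0,g_0), d_1, p_(1,1), ...]. The initial segments
   T[s,t] are exactly the lists [take k T] with [k <= size T]. *)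
Definition trail := seq element.

Definition elit (e : element) : option literal :=
  match e with Decided l => Some l | Propagated x _ => x end.

Definition is_conflict (e : element) : bool :=
  if e is Propagated None _ then true else false.

Definition assigned (T : trail) : seq literal := pmap elit T.

Definition decisions (T : trail) : seq literal :=
  pmap (fun e => if e is Decided l then Some l else None) T.

Definition propagations (T : trail) : seq (literal * clause) :=
  pmap (fun e => if e is Propagated (Some l) A then Some (l, A) else None) T.

(* The trail as a sequence of decided (true) or propagated (false) literals,
   without the antecedents. *)
Definition literals (T : trail) : seq (bool * option literal) :=
  [seq (if e is Decided _ then true else false, elit e) | e <- T].

(* [None] is the satisfied clause. *)
Definition restrict (C : clause) (s : seq literal) : option clause :=
  if has (fun l => l \in s) C then None
  else Some [seq l <- C | neg l \notin s].

(* The clause (x); the empty clause if x is the conflict symbol. *)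
Definition unit_clause (x : option literal) : clause :=
  if x is Some l then [:: l] else [::].

Definition unit_under (Q : quant_prefix) (s : seq literal) (C : clause)
    (x : option literal) : Prop :=
  (if x is Some l then existential Q l.1 else true) /\
  exists2 D, restrict C s = Some D & red Q D =i unit_clause x.

(* Whether a literal may be decided after the given initial segment. *)
Definition policy := qcnf -> trail -> literal -> Prop.

(* The variables of the formula are those bound by its prefix. *)
Definition LEV_ORD : policy := fun Phi T d =>
  forall x, x \in prefix_vars (qprefix Phi) ->
    x \notin [seq l.1 | l <- assigned T] ->
    lv (qprefix Phi) d.1 <= lv (qprefix Phi) x.

Definition ASS_R_ORD : policy := fun Phi T d =>
  existential (qprefix Phi) d.1 ->
  forall u, universal (qprefix Phi) u ->
    lv (qprefix Phi) u < lv (qprefix Phi) d.1 ->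
    u \in [seq l.1 | l <- decisions T].

(* Trails for [Phi] that follow the decision policy [P] and the propagation
   policy RED. *)
Definition is_trail (P : policy) (Phi : qcnf) (T : trail) : Prop :=
  uniq [seq l.1 | l <- assigned T] /\
  forall k e, onth T k = Some e ->
    match e with
    | Decided d =>
        d.1 \in prefix_vars (qprefix Phi) /\ P Phi (take k T) d
    | Propagated x A =>
        [/\ A \in qmatrix Phi,
            unit_under (qprefix Phi) (assigned (take k T)) A x
          & x = None -> k.+1 = size T]
    end.

Definition has_conflict (T : trail) : bool := has is_conflict T.

Definition natural_at (Phi : qcnf) (T : trail) (k : nat) : Prop :=
  let unit_at := unit_under (qprefix Phi) (assigned (take k T)) in
  (exists C x, C \in qmatrix Phi /\ unit_at C x) ->
  exists C x,
    [/\ onth T k = Some (Propagated x C), C \in qmatrix Phi, unit_at C x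
      & (exists2 D, D \in qmatrix Phi & unit_at D None) -> x = None].

Definition natural_from (Phi : qcnf) (T : trail) (k0 : nat) : Prop :=
  forall k, k0 <= k <= size T -> ~~ has_conflict (take k T) ->
    natural_at Phi T k.

Definition natural (Phi : qcnf) (T : trail) : Prop := natural_from Phi T 0.

Definition learn_step (Q : quant_prefix) (d : derivation)
    (p : literal * clause) : derivation :=
  if neg p.1 \in concl Q d then Red (Res p.1 d (Red (Ax p.2))) else d.

(* The derivations of the learnable clauses, from the conflict leftwards. *)
Definition learnable_derivations (Q : quant_prefix) (T : trail) :
    seq derivation :=
  if rev T is Propagated None A :: T' then
    let d := Red (Ax A) in d :: scanl (learn_step Q) d (propagations T')
  else [::].

Record round := Round {
  rtrail : trail;
  rclause : clause;
  rderiv : derivation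
}.

Definition qcdcl_proof := seq round.

Definition extend (Phi : qcnf) (Cs : seq clause) : qcnf :=
  QCNF (qprefix Phi) (qmatrix Phi ++ Cs).

Definition learned (Q : quant_prefix) (R : round) : Prop :=
  (exists j, onth (learnable_derivations Q (rtrail R)) j = Some (rderiv R)) /\
  rclause R =i concl Q (rderiv R).

Definition backtracks (Phi : qcnf) (T' T : trail) : Prop :=
  exists k, [/\ k <= size T', k <= size T,
    take k (literals T) = take k (literals T') & natural_from Phi T k].

Definition is_proof (P : policy) (Phi : qcnf) (C : clause)
    (pi : qcdcl_proof) : Prop :=
  (exists pi' R, pi = rcons pi' R /\ rclause R =i C) /\
  forall i R, onth pi i = Some R ->
    let Phi_i := extend Phi [seq rclause R' | R' <- take i pi] in
    [/\ is_trail P Phi_i (rtrail R), has_conflict (rtrail R),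
        learned (qprefix Phi) R
      & if i is j.+1 then
          exists2 R', onth pi j = Some R' &
            backtracks Phi_i (rtrail R') (rtrail R)
        else natural Phi_i (rtrail R)].

Definition is_refutation (P : policy) (Phi : qcnf) (pi : qcdcl_proof) : Prop :=
  is_proof P Phi [::] pi.

Definition proof_size (pi : qcdcl_proof) : nat :=
  \sum_(R <- pi) size (rtrail R).

Definition word := seq bool.

(* Words are built from the four two-bit symbols 00, 01 (digits) and
   10, 11 (opening and closing bracket). *)
Definition enc_bool (b : bool) : word := [:: false; b].

Definition bracket (w : word) : word :=
  [:: true; false] ++ w ++ [:: true; true].

Definition enc_seq (A : Type) (enc : A -> word) (s : seq A) : word :=
  bracket (flatten (map enc s)).

Fixpoint positive_bits (p : positive) : seq bool :=
  match p with
  | xH => [:: true]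
  | xO p => false :: positive_bits p
  | xI p => true :: positive_bits p
  end.

Definition nat_bits (n : nat) : seq bool :=
  match bin_of_nat n with N0 => [::] | Npos p => positive_bits p end.

Definition enc_nat (n : nat) : word := enc_seq enc_bool (nat_bits n).

Definition enc_literal (l : literal) : word := enc_nat l.1 ++ enc_bool l.2.

Definition enc_clause : clause -> word := enc_seq enc_literal.

Definition enc_block (b : quantifier * seq var) : word :=
  enc_bool b.1 ++ enc_seq enc_nat b.2.

Definition enc_qcnf (Phi : qcnf) : word :=
  enc_seq enc_block (qprefix Phi) ++ enc_seq enc_clause (qmatrix Phi).

Definition enc_element (e : element) : word :=
  match e with
  | Decided l => enc_bool false ++ enc_literal l
  | Propagated x A =>
      enc_bool true ++ enc_clause (unit_clause x) ++ enc_clause A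
  end.

Fixpoint enc_derivation (d : derivation) : word :=
  match d with
  | Ax C => enc_bool false ++ enc_clause C
  | Red d => enc_bool true ++ enc_bool false ++ enc_derivation d
  | Res p d e => enc_bool true ++ enc_bool true ++ enc_literal p ++
                 enc_derivation d ++ enc_derivation e
  end.

Definition enc_round (R : round) : word :=
  bracket (enc_seq enc_element (rtrail R) ++ enc_clause (rclause R) ++
           enc_derivation (rderiv R)).

Definition enc_proof (Phi : qcnf) (pi : qcdcl_proof) : word :=
  enc_qcnf Phi ++ enc_seq enc_round pi.

Definition qcnf_size (Phi : qcnf) : nat := size (enc_qcnf Phi).

(* Deterministic Turing machines with one two-way infinite tape. The tape
   symbols are the blank [None], the bits [Some (inl b)] and finitely many
   auxiliary symbols; the machine halts when [delta] returns [None]. *)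
Record turing_machine := TuringMachine {
  tm_state : finType;
  tm_aux : finType;
  tm_start : tm_state;
  tm_delta : tm_state -> option (bool + tm_aux) ->
    option (tm_state * option (bool + tm_aux) * bool)
}.

Definition tm_symbol (M : turing_machine) := option (bool + tm_aux M).

Definition tm_bit (M : turing_machine) (b : bool) : tm_symbol M := Some (inl b).

(* [(q, l, r)]: the scanned cell is the head of [r], the cells to its left are
   listed by [l] from right to left, and all cells not listed are blank. *)
Definition tm_config (M : turing_machine) :=
  (tm_state M * seq (tm_symbol M) * seq (tm_symbol M))%type.

Definition tm_init (M : turing_machine) (w : word) : tm_config M :=
  (tm_start M, [::], map (@tm_bit M) w).

(* The direction is [true] for a move to the right. *)
Definition tm_step (M : turing_machine) (c : tm_config M) :
    option (tm_config M) :=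
  let: (q, l, r) := c in
  if tm_delta q (head None r) is Some (q', a, d) then
    Some (if d then (q', a :: l, behead r)
          else (q', behead l, head None l :: a :: behead r))
  else None.

Fixpoint tm_run (M : turing_machine) (t : nat) (c : tm_config M) :
    option (tm_config M) :=
  if t is t'.+1 then obind (@tm_run M t') (tm_step c) else Some c.

(* The machine has halted, scanning the first symbol of [w] on a tape that is
   otherwise blank. *)
Definition tm_outputs (M : turing_machine) (c : tm_config M) (w : word) :
    Prop :=
  tm_step c = None /\
  exists i j, c.1.2 = nseq i None /\ c.2 = map (@tm_bit M) w ++ nseq j None.

(* Up to the choice of [k], the functions n ^ k + k bound all polynomials. *)
Definition polytime (h : word -> word) : Prop :=
  exists (M : turing_machine) (k : nat), forall w, exists t c,
    [/\ t <= size w ^ k + k, tm_run t (tm_init M w) = Some c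
      & tm_outputs c (h w)].

(* [S Phi C w]: the word [w] is a proof of [C] from [Phi]. *)
Definition proof_system := qcnf -> clause -> word -> Prop.

Definition QCDCL_RED (P : policy) : proof_system := fun Phi C w =>
  qcnf_wf Phi /\ exists2 pi, is_proof P Phi C pi & w = enc_proof Phi pi.

Definition p_simulates (g f : proof_system) : Prop :=
  exists2 h, polytime h & forall Phi C w, f Phi C w -> g Phi C (h w).

Definition polynomial_size (F : nat -> qcnf) : Prop :=
  exists k, forall n, qcnf_size (F n) <= n ^ k + k.

Definition has_polynomial_refutations (P : policy) (F : nat -> qcnf) : Prop :=
  exists k, forall n, exists2 pi, is_refutation P (F n) pi &
    proof_size pi <= qcnf_size (F n) ^ k + k.

(* Size 2^Omega(n); no threshold on n is needed, since refutations are nonempty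
   and the bound is 1 for n <= c. *)
Definition requires_exponential_refutations (P : policy) (F : nat -> qcnf) :
    Prop :=
  exists c, forall n pi, is_refutation P (F n) pi ->
    2 ^ (n %/ c.+1) <= proof_size pi.

(* Main.v *)
Require Import Defs.
From mathcomp Require Import all_boot zify.

(** A universal literal on a trail is always decided, so every LEV-ORD trail is
already an ASS-R-ORD trail and the identity is a p-simulation.

The separating formulas have prefix [exists x_0..x_(N-1), forall u, exists
t_0..t_(N-1)] and clauses [u \/ x_i \/ t_i], [u \/ ~x_i \/ t_i] for [i < N], and
[W_N], where [W_j = u \/ ~t_0 \/ ... \/ ~t_(j-1)]. An ASS-R-ORD solver decides [~u]
first; deciding [t_0, ..., t_(j-2)] then makes [W_j] propagate [~t_(j-1)], which
conflicts with the two clauses on [x_(j-1)], and [W_(j-1)] is learned. After [N]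
such rounds [W_0 = u] reduces to the empty clause.

A LEV-ORD solver must assign all [x_i] before [u]. Every clause that mentions [u]
contains, for each [i], a literal on [x_i] or [~t_i] (or is an input clause), so
a conflict below [u] can only yield a clause on the [x_i] that excludes the single
current assignment to them. All other clauses on the [x_i] follow by resolution
from those, so refuting the formula takes [2 ^ N] rounds. *)

Set Implicit Arguments.
Unset Strict Implicit.
Unset Printing Implicit Defensive.

Arguments existential : simpl never.
Arguments universal : simpl never.

Notation vars s := [seq l.1 | l : literal <- s].

(** * Literals, trails, restriction and reduction *)

Lemma negK : involutive neg.
Proof. by case=> x b; rewrite /neg negbK. Qed.

Lemma neg_eq l l' : (neg l == l') = (l == neg l').
Proof. exact: (inv_eq negK). Qed.

Lemma onth_take (A : Type) (s : seq A) n k :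
  onth (take n s) k = if k < n then onth s k else None.
Proof.
elim: s n k => [|x s IH] [|n] [|k] //=; first by case: ifP.
by rewrite IH ltnS.
Qed.

Lemma onth_mid (A : Type) (s : seq A) x r : onth (s ++ x :: r) (size s) = Some x.
Proof. by rewrite onth_cat ltnn subnn. Qed.

Lemma onth_split (A : Type) (s : seq A) k x :
  onth s k = Some x -> s = take k s ++ x :: drop k.+1 s.
Proof.
elim: s k => [|y s IH] [|k] //= H; last by rewrite -IH.
by case: H => ->; rewrite drop0.
Qed.

Lemma assigned_cat S R : assigned (S ++ R) = assigned S ++ assigned R.
Proof. exact: pmap_cat. Qed.

Lemma assigned_split T l : l \in assigned T ->
  exists S e R, T = S ++ e :: R /\ elit e = Some l.
Proof.
elim: T => [|e T IH] //=; rewrite /assigned /=.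
case E: (elit e) => [l'|] /=; last first.
  by move=> /IH[S [e' [R [-> He]]]]; exists (e :: S), e', R.
rewrite inE => /orP[/eqP ->|/IH[S [e' [R [-> He]]]]].
  by exists [::], e, T.
by exists (e :: S), e', R.
Qed.

Lemma uniq_vars_neg (s : seq literal) l : uniq (vars s) -> l \in s -> neg l \notin s.
Proof.
elim: s => //= l' s IH /andP[l's us]; rewrite !inE.
case/orP => [/eqP El|ls].
  rewrite -El negb_or; apply/andP; split.
    by rewrite /neg; case: (l) => x []; rewrite xpair_eqE andbF.
  by move: l's; rewrite -El; apply: contra => /(map_f fst).
rewrite negb_or IH // andbT; move: l's; apply: contra => /eqP <-.
exact: (map_f fst ls).
Qed.

Lemma unassigned_mid T S e R l : uniq (vars (assigned T)) -> T = S ++ e :: R ->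
  elit e = Some l -> l.1 \notin vars (assigned S).
Proof.
move=> + ET El; rewrite ET assigned_cat map_cat cat_uniq => /and3P[_ + _].
by rewrite /assigned /= El /= negb_or => /andP[].
Qed.

Lemma restrict_mem C s D l : restrict C s = Some D ->
  (l \in D) = (l \in C) && (neg l \notin s).
Proof. by rewrite /restrict; case: ifP => // _ [<-]; rewrite mem_filter andbC. Qed.

Lemma restrict_unsat C s D l : restrict C s = Some D -> l \in C -> l \notin s.
Proof. by rewrite /restrict; case: ifPn => // /hasPn H _ /H. Qed.

Lemma red_sub Q C : {subset red Q C <= C}.
Proof. by move=> l; rewrite mem_filter => /andP[]. Qed.

Lemma red_non_universal Q C l : l \in C -> ~~ universal Q l.1 -> l \in red Q C.
Proof. by rewrite mem_filter => -> /negbTE ->. Qed.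

Lemma mem_resolvent p C D l : (l \in resolvent p C D) =
  (l \in C) && (l != neg p) || (l \in D) && (l != p).
Proof. by rewrite mem_cat !mem_filter andbC [X in _ || X]andbC. Qed.

(** Reduction never removes a non-universal literal, so one that is not yet falsified would survive
    in the unit clause and have to be the propagated literal itself. *)
Lemma unit_under_falsified Q s A x l : unit_under Q s A x -> l \in A ->
  ~~ universal Q l.1 -> x != Some l -> neg l \in s.
Proof.
case=> _ [D rD rdD] lA nu xl; apply: contraT => nls.
have : l \in red Q D by apply: red_non_universal; rewrite // (restrict_mem _ rD) lA.
rewrite rdD; case: x xl {rdD} => [l'|] //= ll'; rewrite inE => /eqP E.
by rewrite E eqxx in ll'.
Qed.

Lemma unit_under_mem Q s A l : unit_under Q s A (Some l) -> l \in A /\ neg l \notin s.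
Proof.
case=> _ [D rD rdD]; have : l \in red Q D by rewrite rdD mem_head.
by move/red_sub; rewrite (restrict_mem _ rD) => /andP[].
Qed.

Lemma unit_under_unsat Q s A x l : unit_under Q s A x -> l \in A -> l \notin s.
Proof. by case=> _ [D rD _]; apply: restrict_unsat rD. Qed.

Lemma unit_under_existential Q s A l : unit_under Q s A (Some l) -> existential Q l.1.
Proof. by case. Qed.

Lemma conflict_last P Phi T k A :
  is_trail P Phi T -> onth T k = Some (Propagated None A) -> k.+1 = size T.
Proof. by case=> _ H /H[_ _]; apply. Qed.

Lemma conflict_split P Phi T : is_trail P Phi T -> has_conflict T ->
  exists T0 A, T = rcons T0 (Propagated None A).
Proof.
move=> tT; case/lastP: T tT => // T0 e tT hc.
exists T0.
have [i ilt ci] : exists2 i, i < size (rcons T0 e) & is_conflict (nth e (rcons T0 e) i).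
  exact/(has_nthP e).
have Ho : onth (rcons T0 e) i = Some (nth e (rcons T0 e) i).
  by rewrite onthE (nth_map e).
case Ei: (nth e (rcons T0 e) i) ci => [|[] A] // _.
rewrite Ei in Ho; have := conflict_last tT Ho; rewrite size_rcons => -[Es].
by exists A; rewrite Es nth_rcons ltnn eqxx in Ei; rewrite Ei.
Qed.

Lemma no_early_conflict P Phi T k : is_trail P Phi T -> k < size T ->
  ~~ has_conflict (take k T).
Proof.
move=> tT kT; apply/negP => /(has_nthP (Decided (0, true)))[i].
rewrite size_takel ?(ltnW kT) // => ik.
have iT := ltn_trans ik kT.
rewrite nth_take //; case Ei: (nth _ _ _) => [|[] A] // _.
have Ho : onth T i = Some (Propagated None A).
  by rewrite onthE (nth_map (Decided (0, true))) // Ei.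
by have := conflict_last tT Ho; lia.
Qed.

(** * The simulation *)

Lemma polytime_id : polytime id.
Proof.
exists (@TuringMachine unit void tt (fun _ _ => None)), 0 => w.
exists 0, (tm_init _ w); split=> //; split=> //.
by exists 0, 0; rewrite cats0.
Qed.

Lemma quantified_mem q Q x : quantified q Q x -> x \in prefix_vars Q.
Proof.
by case/hasP => b bQ /andP[_ xb]; apply/flattenP; exists b.2; rewrite ?map_f.
Qed.

Lemma existential_universal Q x : uniq (prefix_vars Q) ->
  existential Q x -> universal Q x -> False.
Proof.
rewrite /prefix_vars; elim: Q => //= -[q X] Q IH /=; rewrite cat_uniq.
case/and3P => _ /hasPn xX uQ.
case/orP => [/andP[/= /eqP -> xe]|eQ]; case/orP => [/andP[/= /eqP Eq xu]|aQ] //.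
- by have := xX _ (quantified_mem aQ); rewrite /= xe.
- by have := xX _ (quantified_mem eQ); rewrite /= xu.
exact: IH.
Qed.

Lemma mem_decisions T S d R : T = S ++ Decided d :: R -> d \in decisions T.
Proof. by move=> ->; rewrite /decisions pmap_cat mem_cat /= mem_head orbT. Qed.

Lemma LEV_ORD_trail Phi T : uniq (prefix_vars (qprefix Phi)) ->
  is_trail LEV_ORD Phi T -> is_trail ASS_R_ORD Phi T.
Proof.
move=> uQ [uT HT]; split=> // k e Hk; have := HT k e Hk.
case: e Hk => // d Hk [dQ levd]; split=> // _ u uu lvu.
have : u \in vars (assigned (take k T)).
  apply: contraT => nu; have := levd u (quantified_mem uu) nu.
  by rewrite leqNgt lvu.
case/mapP => l /assigned_split[S [e [R [E El]]]] Eu.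
have Ho : onth T (size S) = Some e.
  have : onth (take k T) (size S) = Some e by rewrite E onth_mid.
  by rewrite onth_take; case: ifP.
case: e Ho El E => [d' _ [->] E|x A /HT[_ + _] /= Ex _].
  by rewrite Eu map_f // (mem_decisions E).
(* Propagated literals are existential, so the universal [u] was not propagated. *)
rewrite Ex => /unit_under_existential; rewrite -Eu => eu.
by case: (existential_universal uQ eu uu).
Qed.

Lemma ASS_R_ORD_p_simulates_LEV_ORD :
  p_simulates (QCDCL_RED ASS_R_ORD) (QCDCL_RED LEV_ORD).
Proof.
exists id => [|Phi C w]; first exact: polytime_id.
case=> wf [pi [last_pi Hpi] ->]; split=> //; exists pi => //; split=> // i R iR.
have [tR cR lR nR] := Hpi i R iR; split=> //.
by apply: LEV_ORD_trail => //; case: wf.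
Qed.

(** * The formulas *)

(* The variable [u] is [0], [x_i] is [i.+1] and [t_i] is [N.+1 + i]. *)
Definition xvar N v := 0 < v <= N.
Definition tvar N v := N < v <= N + N.

Definition block_prefix N : quant_prefix :=
  [:: (qex, iota 1 N); (qall, [:: 0]); (qex, iota N.+1 N)].

Definition choice_clause N i b : clause :=
  [:: (0, true); (i.+1, b); (N.+1 + i, true)].

Definition wide_clause N j : clause :=
  (0, true) :: [seq (N.+1 + i, false) | i <- iota 0 j].

Definition choice_formula N : qcnf :=
  QCNF (block_prefix N)
    ([seq choice_clause N i true | i <- iota 0 N] ++
     [seq choice_clause N i false | i <- iota 0 N] ++ [:: wide_clause N N]).

Lemma existentialE N v : existential (block_prefix N) v = xvar N v || tvar N v.
Proof. by rewrite /existential /quantified /= !mem_iota /xvar /tvar; lia. Qed.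

Lemma universalE N v : universal (block_prefix N) v = (v == 0).
Proof. by rewrite /universal /quantified /= inE !orbF. Qed.

Lemma lv_xvar N v : xvar N v -> lv (block_prefix N) v = 1.
Proof. by rewrite /lv /= mem_iota /xvar => H; case: ifPn => //; lia. Qed.

Lemma lv_uvar N : lv (block_prefix N) 0 = 2.
Proof. by rewrite /lv /= mem_iota. Qed.

Lemma lv_tvar N v : tvar N v -> lv (block_prefix N) v = 3.
Proof.
rewrite /lv /= mem_iota inE mem_iota /tvar => H.
by do ![case: ifPn => //]; lia.
Qed.

Lemma mem_block_prefix N (v : nat) :
  (v \in prefix_vars (block_prefix N)) = [|| xvar N v, v == 0 | tvar N v].
Proof.
by rewrite /prefix_vars /= cats0 mem_cat inE !mem_iota /xvar /tvar; lia.
Qed.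

Lemma mem_wide_clause N j l :
  (l \in wide_clause N j) = (l == (0, true)) || [&& ~~ l.2, N < l.1 & l.1 <= N + j].
Proof.
rewrite inE; congr (_ || _); apply/mapP/idP => [[i + ->]|].
  by rewrite mem_iota /=; lia.
case: l => v [] //= H; exists (v - N.+1); first by rewrite mem_iota; lia.
by congr (_, _); lia.
Qed.

Lemma choice_formulaP N C : reflect
  ((exists i b, i < N /\ C = choice_clause N i b) \/ C = wide_clause N N)
  (C \in qmatrix (choice_formula N)).
Proof.
rewrite /= !mem_cat inE; apply: (iffP or3P) => [[/mapP[i]|/mapP[i]|/eqP ->]|].
- by rewrite mem_iota => iN ->; left; exists i, true.
- by rewrite mem_iota => iN ->; left; exists i, false.
- by right.
case=> [[i [[] [iN ->]]]| ->]; last by constructor 3.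
- by constructor 1; apply/mapP; exists i; rewrite // mem_iota.
- by constructor 2; apply/mapP; exists i; rewrite // mem_iota.
Qed.

Lemma uniq_block_prefix N : uniq (prefix_vars (block_prefix N)).
Proof.
rewrite /prefix_vars /= cats0 cat_uniq /= !iota_uniq !mem_iota andbT /=.
rewrite andbT; apply/hasPn => v; rewrite !mem_iota; lia.
Qed.

Lemma choice_formula_wf N : 0 < N -> qcnf_wf (choice_formula N).
Proof.
move=> N0; split=> //.
- exact: uniq_block_prefix.
- by rewrite /= andbT -!size_eq0 !size_iota; case: (N) N0.
- apply/allP => C /choice_formulaP H; apply/allP => l lC.
  rewrite [qprefix _]/= mem_block_prefix; move: lC.
  case: H => [[i [b [iN ->]]]| ->].
    by rewrite !inE => /or3P[] /eqP -> /=; rewrite /xvar /tvar; lia.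
  rewrite mem_wide_clause => /orP[/eqP -> //|H].
  by rewrite (_ : tvar N l.1) ?orbT // /tvar; lia.
apply/allP => C /choice_formulaP H; apply/hasPn => l.
case: H => [[i [b [iN ->]]]| ->].
  rewrite !inE => /or3P[] /eqP ->; case: b; rewrite /neg /eq_op /= /eq_op /=; lia.
by case: l => v []; rewrite /neg !mem_wide_clause !xpair_eqE /=; lia.
Qed.

(** Agreement outside the block is recorded so that the value of [u] survives the instantiation of
    the [t_i]. *)
Lemma qtrue_rec_ex xs Q phi a : qtrue_rec ([seq (qex, x) | x <- xs] ++ Q) phi a ->
  exists2 a', {in predC (mem xs), a' =1 a} & qtrue_rec Q phi a'.
Proof.
elim: xs a => [|x xs IH] a /=; first by exists a.
case/orP => /IH[a' a'a H]; exists a' => // y; rewrite !inE negb_or.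
- by case/andP=> yx ?; rewrite a'a // /update (negbTE yx).
- by case/andP=> yx ?; rewrite a'a // /update (negbTE yx).
Qed.

(** The universal player sets [u] to false: the two choice clauses for [i] then force [t_i] whatever
    [x_i] is, and the wide clause fails. *)
Lemma choice_formula_false N : ~~ qcnf_true (choice_formula N).
Proof.
apply/negP; rewrite /qcnf_true /= => /qtrue_rec_ex[a _] /= /andP[_].
case/qtrue_rec_ex => a' a'a; rewrite -[qtrue_rec _ _ _]/(cnf_sat _ _) => /allP sat.
have a'0 : a' 0 = false by rewrite a'a // !inE /= mem_iota.
have a't i : i < N -> a' (N.+1 + i) = true.
  move=> iN; case Ex: (a' i.+1).
    have /sat/hasP[l] : choice_clause N i false \in qmatrix (choice_formula N).
      by apply/choice_formulaP; left; exists i, false.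
    by rewrite !inE => /or3P[] /eqP -> /=; rewrite ?a'0 ?Ex // => /eqP.
  have /sat/hasP[l] : choice_clause N i true \in qmatrix (choice_formula N).
    by apply/choice_formulaP; left; exists i, true.
  by rewrite !inE => /or3P[] /eqP -> /=; rewrite ?a'0 ?Ex // => /eqP.
have /sat/hasP[l] : wide_clause N N \in qmatrix (choice_formula N).
  by apply/choice_formulaP; right.
rewrite mem_wide_clause => /orP[/eqP ->|]; first by rewrite a'0.
case: l => v [] //= H; have := a't (v - N.+1).
by rewrite subnKC => [->|]; lia.
Qed.

(** * The lower bound *)

Lemma xvar_not_tvar N v : xvar N v -> tvar N v = false.
Proof. by rewrite /xvar /tvar; lia. Qed.

(** The only universal variable is [u], and only the [t_i] have a higher level, so a literal on [u]
    is protected exactly by the presence of a literal on some [t_i]. *)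
Lemma mem_red N C l : (l \in red (block_prefix N) C) =
  (l \in C) && ((l.1 != 0) || has (fun x => tvar N x.1) C).
Proof.
rewrite mem_filter universalE andbC; case: eqP => //= ->; congr (_ && _).
rewrite lv_uvar -has_predC; apply: eq_has => x /=.
rewrite existentialE; have [X|nX] := boolP (xvar N x.1).
  by rewrite lv_xvar //= xvar_not_tvar.
by have [X|] := boolP (tvar N x.1); rewrite //= lv_tvar.
Qed.

Lemma red_tvar N C t : t \in C -> tvar N t.1 -> red (block_prefix N) C =i C.
Proof.
by move=> tC tt l; rewrite mem_red (_ : has _ C) ?orbT ?andbT //; apply/hasP; exists t.
Qed.

Lemma xvar_neq0 N v : xvar N v -> v != 0.
Proof. by rewrite /xvar; lia. Qed.

Lemma tvar_neq0 N v : tvar N v -> v != 0.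
Proof. by rewrite /tvar; lia. Qed.

Lemma red_xvars N C : (forall l, l \in C -> xvar N l.1) -> red (block_prefix N) C =i C.
Proof.
move=> CX l; rewrite mem_red; have [lC|//] := boolP (l \in C).
by rewrite (xvar_neq0 (CX l lC)).
Qed.

(** Only the values on the [x_i] are kept, in a finite type with [2 ^ N] elements, so that excluded
    assignments can be counted. *)
Definition xcode N (a : assignment) : {ffun 'I_N -> bool} := [ffun i : 'I_N => a i.+1].

Definition choice_like N (C : clause) :=
  exists i b, i < N /\ C =i choice_clause N i b.

(** A class that contains the wide clause of length [N] and is closed under resolution with choice
    clauses over a [t_i]: such a step trades [~t_i] for a literal on [x_i]. *)
Definition covering N (C : clause) :=
  [/\ (0, true) \in C,
      forall l, l \in C -> [|| l == (0, true), xvar N l.1 | tvar N l.1 && ~~ l.2]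
    & forall i, i < N -> (exists b, (i.+1, b) \in C) \/ (N.+1 + i, false) \in C].

(* [E] lists the assignments to the [x_i] that the clauses learned so far exclude. *)
Definition blocking N (E : seq {ffun 'I_N -> bool}) (C : clause) :=
  (forall l, l \in C -> xvar N l.1) /\
  (forall a : assignment, (forall l, l \in C -> a l.1 != l.2) -> xcode N a \in E).

(* The invariant of all clauses that a LEV-ORD solver can learn. *)
Definition tame N (E : seq {ffun 'I_N -> bool}) (C : clause) :=
  [\/ choice_like N C, covering N C /\ (exists2 t, t \in C & tvar N t.1)
    | blocking E C].

Lemma eq_tame N (E : seq {ffun 'I_N -> bool}) C C' : C =i C' -> tame E C -> tame E C'.
Proof.
move=> CC'; case=> [[i [b [iN Ci]]]|[[uC kC cC] [t tC tt]]|[CX bC]].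
- by constructor 1; exists i, b; split=> // l; rewrite -CC'.
- constructor 2; split; last by exists t; rewrite -?CC'.
  split=> [|l|i iN]; rewrite -?CC' //; first exact: kC.
  by case: (cC i iN) => [[b]|]; [left; exists b|right]; rewrite -?CC'.
- constructor 3; split=> [l|a aC]; first by rewrite -CC'; apply: CX.
  by apply: bC => l; rewrite CC'; apply: aC.
Qed.

Lemma sub_tame N (E E' : seq {ffun 'I_N -> bool}) C :
  {subset E <= E'} -> tame E C -> tame E' C.
Proof.
move=> EE' [?|?|[CX bC]]; [by constructor 1|by constructor 2|constructor 3].
by split=> // a aC; apply/EE'/bC.
Qed.

Lemma choice_like_mem N C : choice_like N C ->
  (0, true) \in C /\ exists2 t, t \in C & tvar N t.1.
Proof.
case=> i [b [iN Ci]]; split; first by rewrite Ci !inE.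
by exists (N.+1 + i, true); rewrite ?Ci ?inE ?eqxx ?orbT // /tvar /=; lia.
Qed.

(** The dichotomy that most arguments below use: a tame clause speaks of the [x_i] only, or contains
    [u] together with a literal on some [t_i] that prevents its reduction. *)
Lemma tame_cases N (E : seq {ffun 'I_N -> bool}) C : tame E C ->
  blocking E C \/ ((0, true) \in C /\ exists2 t, t \in C & tvar N t.1).
Proof.
case=> [/choice_like_mem|[[uC _ _] ?]|]; first by right.
- by right.
- by left.
Qed.

Lemma tame_red N (E : seq {ffun 'I_N -> bool}) C :
  tame E C -> tame E (red (block_prefix N) C).
Proof.
move=> tC; apply: eq_tame (tC) => l; apply/esym.
case: (tame_cases tC) => [[CX _]|[_ [t tC' tt]]]; first exact: red_xvars.
exact: (red_tvar tC').
Qed.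

Lemma tame_choice_formula N (E : seq {ffun 'I_N -> bool}) C : 0 < N ->
  C \in qmatrix (choice_formula N) -> tame E C.
Proof.
move=> N0 /choice_formulaP[[i [b [iN ->]]]| ->].
  by constructor 1; exists i, b.
constructor 2; split.
  split=> [|l|i iN]; rewrite ?mem_wide_clause //=.
    by case/orP => [-> //|]; rewrite /tvar => ?; apply/or3P; constructor 3; lia.
  by right; rewrite /=; lia.
by exists (N.+1, false); rewrite /tvar ?mem_wide_clause /=; lia.
Qed.

(** An unfalsified literal on a [t_i] blocks the reduction of [u], and [u] is not existential, so
    [u] can only have disappeared by being falsified. Hence propagating a [t_i] from such a clause
    presupposes [~u] on the trail. *)
Lemma unit_under_uvar N s A x t : unit_under (block_prefix N) s A x ->
  (0, true) \in A -> t \in A -> tvar N t.1 -> neg t \notin s -> (0, false) \in s.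
Proof.
case=> ex [D rD rdD] uA tA tt ts; apply: contraT => us.
have uD : (0, true) \in D by rewrite (restrict_mem _ rD) uA.
have tD : t \in D by rewrite (restrict_mem _ rD) tA.
have := red_tvar tD tt (0, true); rewrite uD rdD.
case: x ex {rdD} => [l|] //= ex; rewrite inE => /eqP E.
by move: ex; rewrite -E existentialE.
Qed.

(** * The order of literals on LEV-ORD trails *)

Lemma trail_step P Phi T S e R : is_trail P Phi T -> T = S ++ e :: R ->
  match e with
  | Decided d => d.1 \in prefix_vars (qprefix Phi) /\ P Phi S d
  | Propagated x A =>
      [/\ A \in qmatrix Phi, unit_under (qprefix Phi) (assigned S) A x
        & x = None -> R = [::]]
  end.
Proof.
move=> [_ H] ET; have := H (size S) e; rewrite ET onth_mid take_size_cat //.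
move=> /(_ erefl); case: e {ET} => // x A [AM U L]; split=> // /L.
by rewrite size_cat /= => Es; apply: size0nil; lia.
Qed.

(** For a decision this is the policy. A propagated [t_i] needs [~u] earlier on the trail, and the
    induction hypothesis applies to that element. *)
Lemma xvars_first N E Phi T : qprefix Phi = block_prefix N ->
  {in qmatrix Phi, forall C, @tame N E C} -> is_trail LEV_ORD Phi T ->
  forall S e R l x, T = S ++ e :: R -> elit e = Some l -> ~~ xvar N l.1 ->
  xvar N x -> x \in vars (assigned S).
Proof.
move=> QE tM tT S; have [n] := ubnP (size S).
elim: n S => // n IH S; rewrite ltnS => Sn e R l x ET El lX xX.
have := trail_step tT ET; case: e ET El => [d|y A] ET /= El.
  case: El lX => <- dX; rewrite QE mem_block_prefix (negbTE dX) /= => -[dQ levd].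
  apply: contraT => nx; have := levd x; rewrite QE mem_block_prefix xX => /(_ erefl nx).
  by rewrite (lv_xvar xX); case/orP: dQ => [/eqP ->|/lv_tvar ->]; rewrite ?lv_uvar.
rewrite QE => -[AM + _]; rewrite El => U.
have lT : tvar N l.1.
  by have := unit_under_existential U; rewrite existentialE (negbTE lX).
have [lA ls] := unit_under_mem U.
have [[AX _]|[uA _]] := tame_cases (tM A AM); first by rewrite AX in lX.
have /assigned_split[S1 [e1 [S2 [ES E1]]]] := unit_under_uvar U uA lA lT ls.
have : x \in vars (assigned S1).
  apply: (IH S1 _ e1 (S2 ++ Propagated y A :: R) (0, false)) => //.
    by move: Sn; rewrite ES size_cat /=; lia.
  by rewrite ET ES -catA.
by rewrite ES assigned_cat map_cat mem_cat => ->.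
Qed.

(** Any other literal before [p] would come after all the [x_i], so the variable of [p] would be
    assigned twice. *)
Lemma xvar_prefix N E Phi T : qprefix Phi = block_prefix N ->
  {in qmatrix Phi, forall C, @tame N E C} -> is_trail LEV_ORD Phi T ->
  forall S e R p, T = S ++ e :: R -> elit e = Some p -> xvar N p.1 ->
  forall l, l \in assigned S -> xvar N l.1.
Proof.
move=> QE tM tT S e R p ET Ep pX l /assigned_split[S1 [e1 [S2 [ES E1]]]].
apply: contraT => lX; have := unassigned_mid tT.1 ET Ep.
rewrite ES assigned_cat map_cat mem_cat.
rewrite (xvars_first QE tM tT (S := S1) (e := e1) (R := S2 ++ e :: R) (l := l)) //.
by rewrite ET ES -catA.
Qed.

(** A literal on a [t_i] in the antecedent would have to be falsified before [p], where only
    literals on the [x_i] occur. *)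
Lemma xvar_antecedent N E Phi T : qprefix Phi = block_prefix N ->
  {in qmatrix Phi, forall C, @tame N E C} -> is_trail LEV_ORD Phi T ->
  forall S p A R, T = S ++ Propagated (Some p) A :: R -> xvar N p.1 -> blocking E A.
Proof.
move=> QE tM tT S p A R ET pX; have [AM + _] := trail_step tT ET.
rewrite QE => U; have [//|[uA [t tA tt]]] := tame_cases (tM A AM).
have : neg t \in assigned S.
  apply: unit_under_falsified U tA _ _; first by rewrite universalE (tvar_neq0 tt).
  by apply: contraTneq tt => -[<-]; rewrite xvar_not_tvar.
by move/(xvar_prefix QE tM tT ET erefl pX) => /xvar_not_tvar; rewrite tt.
Qed.

(* The assignment of a trail to the [x_i]; unassigned ones are read as false. *)
Definition trail_code N (s : seq literal) : {ffun 'I_N -> bool} :=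
  [ffun i : 'I_N => (i.+1, true) \in s].

(** The resolvent is again covering. If no literal on a [t_i] is left, reduction removes [u], and
    what remains has a literal on every [x_i], all falsified by [s]: it excludes the single
    assignment read off from [s]. The resolvent [R] is described by its members because the covering
    clause may be either premise. *)
Lemma tame_covering_resolvent N (E : seq {ffun 'I_N -> bool}) s (C D R : clause) i b :
  uniq (vars s) -> covering N C -> i < N -> D =i choice_clause N i b ->
  (forall l, (l \in R) = (l \in C) && (l != (N.+1 + i, false)) ||
                         (l \in D) && (l != (N.+1 + i, true))) ->
  (forall l, l \in R -> xvar N l.1 -> neg l \in s) ->
  tame (trail_code N s :: E) (red (block_prefix N) R).
Proof.
move=> us [uC kC cC] iN Di HR Rs.
have cR : covering N R.
  split=> [|l|j jN].
  - by rewrite HR uC.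
  - rewrite HR => /orP[/andP[/kC //]|]; rewrite Di !inE.
    case/andP => /or3P[] /eqP -> //=; last by rewrite eqxx.
    by move=> _; rewrite /xvar; lia.
  - have [->|ji] := eqVneq j i.
      left; exists b; rewrite HR; apply/orP; right; apply/andP; split.
        by rewrite Di !inE eqxx orbT.
      by rewrite xpair_eqE; lia.
    case: (cC j jN) => [[c cj]|tj]; [left; exists c|right]; rewrite HR ?cj ?tj /= ?orbF.
      by apply/orP; left; rewrite xpair_eqE; lia.
    by rewrite xpair_eqE; lia.
have [/hasP[t tR tt]|nT] := boolP (has (fun l => tvar N l.1) R).
  apply: eq_tame (_ : tame _ R) => [l|]; first by rewrite (red_tvar tR).
  by constructor 2; split=> //; exists t.
case: cR => _ kR cR; constructor 3; split=> [l|a aR].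
  rewrite mem_red (negbTE nT) orbF => /andP[lR l0].
  case/or3P: (kR l lR) => [/eqP E0|//|/andP[tl _]]; first by rewrite E0 in l0.
  by have /hasPn/(_ l lR) := nT; rewrite tl.
rewrite inE; apply/orP; left; apply/eqP/ffunP => j; rewrite !ffunE.
case: (cR j (ltn_ord j)) => [[c cj]|tj]; last first.
  by have /hasPn/(_ _ tj) := nT; rewrite /tvar /=; have := ltn_ord j; lia.
have := aR (j.+1, c); rewrite mem_red cj => /(_ erefl) /= ac.
have := Rs _ cj; rewrite /xvar /= => /(_ (ltn_ord j)).
case: c {cj} ac => /= ac js; last by rewrite js; case: (a _) ac.
by have := uniq_vars_neg us js; rewrite negK => /negbTE ->; case: (a _) ac.
Qed.

(** Soundness of resolution: an assignment that falsifies the resolvent falsifies one of the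
    premises, according to its value on the pivot. *)
Lemma tame_blocking_resolvent N (E E' : seq {ffun 'I_N -> bool}) C A p :
  {subset E <= E'} -> blocking E' C -> blocking E A ->
  tame E' (red (block_prefix N) (resolvent p C (red (block_prefix N) A))).
Proof.
move=> EE' [CX bC] [AX bA]; apply/tame_red; constructor 3; split=> [l|a aR].
  by rewrite mem_resolvent red_xvars // => /orP[/andP[/CX //]|/andP[/AX]].
have [ap|ap] := eqVneq (a p.1) p.2.
  apply: bC => l lC; have [->|ne] := eqVneq l (neg p).
    by rewrite /= ap; case: p.2.
  by apply: aR; rewrite mem_resolvent ne lC.
apply/EE'/bA => l lA; have [->//|ne] := eqVneq l p.
by apply: aR; rewrite mem_resolvent ne red_xvars // lA orbT.
Qed.

(* Literals on the [x_i] may be falsified by decisions, which learning skips, so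
   only for the [t_i] is the shrinking initial segment [S] tracked. *)
Definition falsified_at N (T S : trail) (C : clause) := forall l, l \in C ->
  (xvar N l.1 -> neg l \in assigned T) /\ (tvar N l.1 -> neg l \in assigned S).

Lemma learn_step_tame N E Phi T S p A R C : qprefix Phi = block_prefix N ->
  {in qmatrix Phi, forall C, @tame N E C} -> is_trail LEV_ORD Phi T ->
  T = S ++ Propagated (Some p) A :: R -> neg p \in C ->
  tame (trail_code N (assigned T) :: E) C ->
  falsified_at N T (rcons S (Propagated (Some p) A)) C ->
  let C1 := red (block_prefix N) (resolvent p C (red (block_prefix N) A)) in
  tame (trail_code N (assigned T) :: E) C1 /\ falsified_at N T S C1.
Proof.
move=> QE tM tT ET pC tC fC C1; have [AM + _] := trail_step tT ET; rewrite QE => U.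
have [pA ps] := unit_under_mem U.
set Rv := resolvent p C _ in C1 *.
have inS l : neg l \in assigned (rcons S (Propagated (Some p) A)) -> l != neg p ->
    neg l \in assigned S.
  by rewrite -cats1 assigned_cat mem_cat inE -neg_eq => /orP[//|->].
have ST l : l \in assigned S -> l \in assigned T.
  by rewrite ET assigned_cat mem_cat => ->.
have fR : falsified_at N T S Rv.
  move=> l; rewrite mem_resolvent => /orP[/andP[lC lp]|/andP[/red_sub lA lp]].
    by split=> [/(proj1 (fC l lC))|/(proj2 (fC l lC)) /inS]; last exact.
  have nS : l.1 != 0 -> neg l \in assigned S.
    move=> l0; apply: unit_under_falsified U lA _ _; first by rewrite universalE.
    by apply: contra lp => /eqP[->].
  by split=> [/xvar_neq0/nS/ST|/tvar_neq0/nS].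
split; last by move=> l /red_sub/fR.
(* Pivot on an [x_i]: both premises are blocking. A literal on a [t_i] in [C] would have been
   falsified before [p], where only literals on the [x_i] occur. *)
have [pX|pX] := boolP (xvar N p.1).
  have bA := xvar_antecedent QE tM tT ET pX.
  apply: tame_blocking_resolvent bA => [x|]; first by rewrite inE => ->; rewrite orbT.
  have [//|[_ [t tC' tt]]] := tame_cases tC.
  have tp : t != neg p by apply: contraTneq tt => ->; rewrite xvar_not_tvar.
  have := xvar_prefix QE tM tT ET erefl pX (inS _ (proj2 (fC t tC') tt) tp).
  by move/xvar_not_tvar; rewrite /= tt.
have pT : tvar N p.1.
  by have := unit_under_existential U; rewrite existentialE (negbTE pX).
have rA := red_tvar pA pT.
have RvT l : l \in Rv -> xvar N l.1 -> neg l \in assigned T by move=> /fR[].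
(* Pivot on a [t_i]: it occurs positively only in choice-like clauses and negatively only in
   covering ones, so the sign of [p] tells which premise is of which kind. *)
case: p => v [] in ET pA pC pT @Rv @C1 RvT {fC inS U ps fR pX} *.
  have cC : covering N C.
    case: tC => [[j [c [jN Cj]]]|[//]|[CX _]].
      move: pC; rewrite Cj !inE => /or3P[] /eqP[] // Ev _.
      by move: pT; rewrite Ev /tvar /=; lia.
    by have /xvar_not_tvar := CX _ pC; rewrite pT.
  case: (tM A AM) => [[i [b [iN Ai]]]|[[_ kA _] _]|[AX _]].
  - have Ev : v = N.+1 + i.
      move: pA; rewrite Ai !inE => /or3P[] /eqP[] // Ev; first by rewrite Ev in pT.
      by move: pT; rewrite Ev /tvar /=; lia.
    apply: (tame_covering_resolvent _ tT.1 cC iN Ai) RvT => l.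
    by rewrite mem_resolvent rA Ev.
  - move: (kA _ pA); rewrite /= andbF orbF => /orP[/eqP[E0]|].
      by rewrite E0 in pT.
    by move/xvar_not_tvar; rewrite pT.
  - by have /xvar_not_tvar := AX _ pA; rewrite pT.
have cA : covering N A.
  case: (tM A AM) => [[j [c [jN Aj]]]|[//]|[AX _]].
    move: pA; rewrite Aj !inE => /or3P[] /eqP[] // Ev _.
    by move: pT; rewrite Ev /tvar /=; lia.
  by have /xvar_not_tvar := AX _ pA; rewrite pT.
case: tC => [[i [b [iN Ci]]]|[[_ kC _] _]|[CX _]].
- have Ev : v = N.+1 + i.
    move: pC; rewrite Ci !inE => /or3P[] /eqP[] // Ev; first by rewrite Ev in pT.
    by move: pT; rewrite Ev /tvar /=; lia.
  apply: (tame_covering_resolvent _ tT.1 cA iN Ci) RvT => l.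
  by rewrite mem_resolvent rA Ev orbC.
- move: (kC _ pC); rewrite /= andbF orbF => /orP[/eqP[E0]|].
    by rewrite E0 in pT.
  by move/xvar_not_tvar; rewrite pT.
- by have /xvar_not_tvar := CX _ pC; rewrite pT.
Qed.

(** Learning passes over decisions without resolving, so a decided [t_i] could stay in the clause
    and break [falsified_at]. *)
Definition no_late_decision N (T : trail) :=
  forall k d, onth T k = Some (Decided d) -> ~~ tvar N d.1.

Lemma scanl_learn_tame N E Phi T : qprefix Phi = block_prefix N ->
  {in qmatrix Phi, forall C, @tame N E C} -> is_trail LEV_ORD Phi T ->
  no_late_decision N T ->
  let E' := trail_code N (assigned T) :: E in
  let Q := block_prefix N in
  forall S e R d, T = S ++ e :: R -> tame E' (concl Q d) ->
  falsified_at N T S (concl Q d) -> forall j d',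
  onth (d :: scanl (learn_step Q) d (propagations (rev S))) j = Some d' ->
  tame E' (concl Q d').
Proof.
move=> QE tM tT nlT E' Q; elim/last_ind => [|S f IH] e R d ET td fd j d'.
  by move/onth1P => [_ <-].
rewrite cat_rcons in ET; rewrite rev_rcons.
have := trail_step tT ET; case: f ET fd => [l|[p|] A] ET fd Hf.
- apply: (IH (Decided l) (e :: R) d ET td) => l' l'd.
  have [fx ft] := fd l' l'd; split=> // /[dup] tl' /ft.
  rewrite -cats1 assigned_cat mem_cat inE => /orP[//|/eqP El].
  have := nlT (size S) l; rewrite ET onth_mid => /(_ erefl).
  by rewrite -El /= tl'.
- rewrite [propagations _]/=; case: j => [[<-] //|j].
  apply: (IH _ (e :: R) _ ET); rewrite /learn_step /=; case: ifPn => // pd.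
  + by have [] := learn_step_tame QE tM tT ET pd td fd.
  + by have [] := learn_step_tame QE tM tT ET pd td fd.
  + move=> l ld; have [fx ft] := fd l ld; split=> // /ft.
    rewrite -cats1 assigned_cat mem_cat inE => /orP[//|/eqP El].
    by move: pd; rewrite -El negK ld.
(* A conflict ends the trail, but here [e] follows. *)
- by case: Hf => _ _ /(_ erefl).
Qed.

Lemma learnable_tame N E Phi T j d : qprefix Phi = block_prefix N ->
  {in qmatrix Phi, forall C, @tame N E C} -> is_trail LEV_ORD Phi T ->
  has_conflict T -> no_late_decision N T ->
  onth (learnable_derivations (block_prefix N) T) j = Some d ->
  tame (trail_code N (assigned T) :: E) (concl (block_prefix N) d).
Proof.
move=> QE tM tT cT nlT; have [T0 [A ET]] := conflict_split tT cT.
rewrite -cats1 in ET.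
rewrite /learnable_derivations {1}ET rev_cat /=.
have [AM + _] := trail_step tT ET; rewrite QE => U.
apply: (scanl_learn_tame QE tM tT nlT ET).
  apply/tame_red/(sub_tame _ (tM A AM)) => x xE; exact: mem_behead.
move=> l /red_sub lA.
have nS : l.1 != 0 -> neg l \in assigned T0.
  by move=> l0; apply: unit_under_falsified U lA _ _ => //; rewrite universalE.
split=> [/xvar_neq0/nS|/tvar_neq0/nS //].
by rewrite ET assigned_cat mem_cat => ->.
Qed.

(* Once all [x_i] and [~u] are on the trail, every unassigned [t_i] is unit, so
   naturality forbids deciding it; under [u] only a clause on the [x_i] can be
   falsified, and the conflict would have come earlier. *)
Lemma natural_no_late_decision N E Phi T k0 : qprefix Phi = block_prefix N ->
  {in qmatrix Phi, forall C, @tame N E C} ->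
  {subset qmatrix (choice_formula N) <= qmatrix Phi} ->
  is_trail LEV_ORD Phi T -> has_conflict T -> natural_from Phi T k0 ->
  (forall k d, k < k0 -> onth T k = Some (Decided d) -> ~~ tvar N d.1) ->
  no_late_decision N T.
Proof.
move=> QE tM sM tT cT nT early k d Tk.
have [|k0k] := ltnP k k0; first by move=> /early; apply.
apply/negP => dt.
have kT : k < size T by rewrite -onthTE Tk.
(* Element [k] is a decision, so by naturality no clause is unit before it. *)
have noU C x : C \in qmatrix Phi ->
    ~ unit_under (block_prefix N) (assigned (take k T)) C x.
  move=> CM CU; have := nT k; rewrite k0k (ltnW kT) => /(_ erefl).
  case/(_ (no_early_conflict tT kT))=> [|C' [x' []]]; last by rewrite Tk.
  by exists C, x; rewrite QE.
have ET := onth_split Tk.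
set S := take k T in ET noU *; set s := assigned S in noU *.
have us : uniq (vars s).
  by have := tT.1; rewrite ET assigned_cat map_cat cat_uniq => /and3P[].
have [dQ levd] := trail_step tT ET.
have Xs x : xvar N x -> x \in vars s.
  by apply: (xvars_first QE tM tT ET erefl); apply/negP => /xvar_not_tvar; rewrite dt.
have : 0 \in vars s.
  apply: contraT => n0; have := levd 0; rewrite QE mem_block_prefix orbT.
  move=> /(_ erefl n0).
  by rewrite lv_uvar lv_tvar.
case/mapP => -[v [] us0 /= Ev]; rewrite -{v}Ev in us0.
  (* Case [u] true: a conflict antecedent containing [u] would be satisfied, so it is blocking and
     already falsified by [s]. *)
  have [T0 [A ET0]] := conflict_split tT cT; rewrite -cats1 in ET0.
  have [AM + _] := trail_step tT ET0; rewrite QE => U.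
  have kT0 : k <= size T0 by move: kT; rewrite ET0 size_cat /= addn1 ltnS.
  have sT0 : {subset s <= assigned T0}.
    move=> l; rewrite /s /S ET0 takel_cat // => ls.
    by rewrite -(cat_take_drop k T0) assigned_cat mem_cat ls.
  have [[AX _]|[uA _]] := tame_cases (tM A AM); last first.
    by have := unit_under_unsat U uA; rewrite sT0.
  apply: (noU A None AM); split=> //; exists [::] => //.
  rewrite /restrict; case: ifPn => [/hasP[l lA ls]|_].
    by have := unit_under_unsat U lA; rewrite sT0.
  congr Some; apply/eqP; rewrite -size_eq0 size_filter -leqn0 leqNgt -has_count.
  apply/hasPn => l lA; rewrite negbK.
  case/mapP: (Xs _ (AX l lA)) => l' l's Ev.
  have [E'|] := eqVneq l' (neg l); first by rewrite -E'.
  move=> ne; suff El : l' = l by have := unit_under_unsat U lA; rewrite -El sT0.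
  case: l l' Ev ne {lA l's} => [v b] [v' b'] /= ->; rewrite /neg xpair_eqE eqxx /=.
  by case: b b' => [] [].
pose i := d.1 - N.+1.
have iN : i < N by move: dt; rewrite /tvar /i; lia.
have Ed : d.1 = N.+1 + i by move: dt; rewrite /tvar /i; lia.
have nd : d.1 \notin vars s by apply: (unassigned_mid tT.1 ET).
have /mapP[[v b] vs /= Ev] : i.+1 \in vars s by apply: Xs; rewrite /xvar.
rewrite -{v}Ev in vs.
(* Case [u] false: of the two choice clauses for [i], this is the one whose literal on [x_i] the
   trail falsifies, so it propagates [t_i]. *)
apply: (noU (choice_clause N i (~~ b)) (Some (N.+1 + i, true))).
  by apply/sM/choice_formulaP; left; exists i, (~~ b).
have nt c : (N.+1 + i, c) \notin s by apply: contra nd => /(map_f fst); rewrite Ed.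
split; first by rewrite existentialE /= -Ed dt orbT.
exists [:: (N.+1 + i, true)].
  rewrite /restrict /= (negbTE (nt true)) (negbTE (uniq_vars_neg us us0)).
  by rewrite (negbTE (uniq_vars_neg us vs)) /neg /= us0 negbK vs (nt false).
by apply: (@red_tvar N _ (N.+1 + i, true)); rewrite ?inE //= -Ed.
Qed.

(** Each round adds at most one code to [E]. The third component is carried along because the part
    of a trail kept by backtracking need not be natural for the current clauses; its decisions were
    made in the previous round. *)
Lemma rounds_tame N pi i : 0 < N -> is_refutation LEV_ORD (choice_formula N) pi ->
  i <= size pi -> exists E : seq {ffun 'I_N -> bool},
  [/\ size E <= i, {in [seq rclause R | R <- take i pi], forall C, tame E C}
    & forall j R, j < i -> onth pi j = Some R -> no_late_decision N (rtrail R)].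
Proof.
move=> N0 [_ Hpi]; elim: i => [|i IH] ipi.
  by exists [::]; split=> // C; rewrite take0.
have [E [sE tE nE]] := IH (ltnW ipi).
have [R pii] : exists R, onth pi i = Some R.
  by move: ipi; rewrite -onthTE; case: (onth pi i) => // R _; exists R.
have [tR cR [[j lj] lR] nR] := Hpi i R pii.
set Phi := extend _ _ in tR nR.
have tM : {in qmatrix Phi, forall C, tame E C}.
  by move=> C; rewrite mem_cat => /orP[/(tame_choice_formula _ N0)|/tE].
have sM : {subset qmatrix (choice_formula N) <= qmatrix Phi}.
  by move=> C CM; rewrite mem_cat CM.
have nlR : no_late_decision N (rtrail R).
  case: i pii nE {IH ipi sE tE} @Phi tR tM sM nR => [|i] pii nE Phi tR tM sM nR.
    exact: (natural_no_late_decision (k0 := 0) _ tM sM tR cR).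
  case: nR => R' R'i [k [kT' kT Ek nk]].
  apply: (natural_no_late_decision _ tM sM tR cR nk) => // m d mk Hm.
  apply: (nE i R' (ltnSn i) R'i m).
  have : onth (take k (literals (rtrail R))) m = Some (true, Some d).
    by rewrite onth_take mk onth_map Hm.
  rewrite Ek onth_take mk onth_map; case: (onth (rtrail R') m) => [[d'|x A]|] //=.
  by case=> ->.
exists (trail_code N (assigned (rtrail R)) :: E); split=> //.
- move=> C; rewrite (take_nth R) // map_rcons mem_rcons inE => /orP[/eqP ->|/tE tC].
    rewrite (onth_nth R _ _ _ pii).
    apply: eq_tame (learnable_tame _ tM tR cR nlR lj) => // l; exact/esym/lR.
  by apply: sub_tame tC => x xE; exact: mem_behead.
move=> k R'; rewrite ltnS leq_eqVlt => /orP[/eqP ->|ki]; last exact: nE.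
by rewrite pii => -[<-].
Qed.

Lemma size_proof_size pi :
  (forall i R, onth pi i = Some R -> 0 < size (rtrail R)) -> size pi <= proof_size pi.
Proof.
rewrite /proof_size; elim: pi => [|R pi IH] H; rewrite ?big_nil ?big_cons //=.
rewrite -add1n; apply: leq_add; first exact: (H 0).
by apply: IH => i; apply: (H i.+1).
Qed.

(** The empty clause is falsified by every assignment, so [E] must list all [2 ^ N] codes, while it
    has at most one entry per round. *)
Lemma LEV_ORD_lower_bound N pi : 0 < N ->
  is_refutation LEV_ORD (choice_formula N) pi -> 2 ^ N <= proof_size pi.
Proof.
move=> N0 rpi; have [E [sE tE _]] := rounds_tame N0 rpi (leqnn _).
have [[pi' [R [Epi R0]]] Hpi] := rpi.
have bE : blocking E (rclause R).
  have /tame_cases[//|[]] : tame E (rclause R).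
    by apply: tE; rewrite take_size Epi map_rcons mem_rcons mem_head.
  by rewrite R0.
have allE (f : {ffun 'I_N -> bool}) : f \in E.
  (* An assignment with code [f]: since [x_i] is the variable [i.+1], the index is [v.-1]. The
     values on other variables do not affect the code. *)
  have [_ /(_ (fun v => if insub v.-1 is Some i then f i else false))] := bE.
  rewrite (_ : xcode _ _ = f) => [|]; first by apply => l; rewrite R0.
  by apply/ffunP => i; rewrite ffunE /= valK.
have : 2 ^ N <= size E.
  rewrite -[2]card_bool -[X in _ ^ X]card_ord -card_ffun cardT.
  by apply: uniq_leq_size; rewrite ?enum_uniq.
move/leq_trans; apply; apply: leq_trans sE _.
apply: size_proof_size => i R' /Hpi[_ + _ _]; by case: (rtrail R').
Qed.

(** * The short refutation *)

Lemma eq_red N C D : C =i D -> red (block_prefix N) C =i red (block_prefix N) D.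
Proof. by move=> CD l; rewrite !mem_red CD (eq_has_r CD). Qed.

(** The literals left after restriction are those of the unit clause, hence existential, and
    reduction has nothing to remove. *)
Lemma unit_underI N s (A : clause) x :
  (if x is Some l then existential (block_prefix N) l.1 else true) ->
  (forall l, l \in A -> l \notin s) ->
  (forall l, (l \in A) && (neg l \notin s) = (l \in unit_clause x)) ->
  unit_under (block_prefix N) s A x.
Proof.
move=> ex As Ax; split; first by case: x ex {Ax}.
exists [seq l <- A | neg l \notin s].
  by rewrite /restrict; case: ifPn => // /hasP[l /As /negbTE ->].
have mD l : (l \in [seq l <- A | neg l \notin s]) = (l \in unit_clause x).
  by rewrite mem_filter andbC.
move=> l; rewrite mem_red mD; case: x ex {Ax mD} => //= l' ex.
rewrite inE; case: eqP => //= ->; move: ex; rewrite existentialE.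
by case/orP => [/xvar_neq0|/tvar_neq0] ->.
Qed.

(** Neither of the two literals can be reduced away, so both would have to be the propagated one. *)
Lemma not_unit_under N s A x l l' : l \in A -> l' \in A -> l != l' ->
  l.1 != 0 -> l'.1 != 0 -> neg l \notin s -> neg l' \notin s ->
  ~ unit_under (block_prefix N) s A x.
Proof.
move=> lA l'A ll' l0 l'0 ns ns' U.
have : x = Some l.
  apply/eqP; apply: contraNT ns; apply: unit_under_falsified U lA _.
  by rewrite universalE.
move=> Ex; move: ns'; rewrite (unit_under_falsified U l'A) ?universalE //.
by rewrite Ex; apply: contra ll' => /eqP[->].
Qed.

Lemma not_conflict_under N s A l : l \in A -> l.1 != 0 -> neg l \notin s ->
  ~ unit_under (block_prefix N) s A None.
Proof.
move=> lA l0 ns U; move: ns; rewrite (unit_under_falsified U lA) //.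
by rewrite universalE.
Qed.

Lemma not_unit_under_sat Q s A x l : l \in A -> l \in s -> ~ unit_under Q s A x.
Proof. by move=> lA ls U; have := unit_under_unsat U lA; rewrite ls. Qed.

Definition t_decisions N m : trail := [seq Decided (N.+1 + i, true) | i <- iota 0 m].

(** The trail from which [W_m] is learned: after [~u] and [t_0], ..., [t_(m-1)], the clause
    [W_(m+1)] forces [~t_m], and the choice clauses for [m] conflict. *)
Definition short_trail N m : trail :=
  Decided (0, false) :: t_decisions N m ++
  [:: Propagated (Some (N.+1 + m, false)) (wide_clause N m.+1);
      Propagated (Some (m.+1, true)) (choice_clause N m true);
      Propagated None (choice_clause N m false)].

(* [W_m]; the clause learned is reduced, which matters for [m = 0] only. *)
Definition short_clause N m : clause := if m is 0 then [::] else wide_clause N m.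

Definition short_derivation N m : derivation :=
  Red (Res (N.+1 + m, false)
    (Red (Res (m.+1, true) (Red (Ax (choice_clause N m false)))
              (Red (Ax (choice_clause N m true)))))
    (Red (Ax (wide_clause N m.+1)))).

Definition short_round N m : round :=
  Round (short_trail N m) (short_clause N m) (short_derivation N m).

(** Round [k] learns [W_(N-k-1)], counting down to the empty clause in round [N - 1]. *)
Definition short_refutation N : qcdcl_proof :=
  [seq short_round N (N - k.+1) | k <- iota 0 N].

Definition u_t_literals N q : seq literal :=
  (0, false) :: [seq (N.+1 + i, true) | i <- iota 0 q].

Lemma mem_u_t_literals N q l :
  (l \in u_t_literals N q) = (l == (0, false)) || [&& l.2, N < l.1 & l.1 <= N + q].
Proof.
rewrite inE; congr (_ || _); apply/mapP/idP => [[i + ->]|].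
  by rewrite mem_iota /=; lia.
case: l => v [] //= H; exists (v - N.+1); first by rewrite mem_iota; lia.
by congr (_, _); lia.
Qed.

Lemma size_t_decisions N m : size (t_decisions N m) = m.
Proof. by rewrite size_map size_iota. Qed.

Lemma size_short_trail N m : size (short_trail N m) = m.+4.
Proof. by rewrite /= size_cat size_t_decisions /= addn3. Qed.

Lemma assigned_t_decisions N m :
  assigned (t_decisions N m) = [seq (N.+1 + i, true) | i <- iota 0 m].
Proof. by rewrite /t_decisions; elim: (iota 0 m) => //= i s <-. Qed.

Lemma assigned_short_trail N m q : q <= m ->
  assigned (take q.+1 (short_trail N m)) = u_t_literals N q.
Proof.
move=> qm; rewrite /= takel_cat ?size_t_decisions // -map_take take_iota.
by rewrite (minn_idPl qm) /assigned /= -/(assigned _) assigned_t_decisions.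
Qed.

Lemma take_short_trail N m j : take (m.+1 + j) (short_trail N m) =
  Decided (0, false) :: t_decisions N m ++ take j
  [:: Propagated (Some (N.+1 + m, false)) (wide_clause N m.+1);
      Propagated (Some (m.+1, true)) (choice_clause N m true);
      Propagated None (choice_clause N m false)].
Proof.
by rewrite addSn /= take_cat size_t_decisions ltnNge leq_addr /= addKn.
Qed.

Lemma assigned_short_trail2 N m :
  assigned (take m.+2 (short_trail N m)) = rcons (u_t_literals N m) (N.+1 + m, false).
Proof.
rewrite -addn1 take_short_trail -cat1s !assigned_cat assigned_t_decisions.
by rewrite -cats1.
Qed.

Lemma assigned_short_trail3 N m : assigned (take m.+3 (short_trail N m)) =
  u_t_literals N m ++ [:: (N.+1 + m, false); (m.+1, true)].
Proof.
by rewrite -addn2 take_short_trail -cat1s !assigned_cat assigned_t_decisions.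
Qed.

Lemma onth_short_trail N m k : onth (short_trail N m) k =
  if k is k'.+1 then
    if k' < m then Some (Decided (N.+1 + k', true)) else
    onth [:: Propagated (Some (N.+1 + m, false)) (wide_clause N m.+1);
      Propagated (Some (m.+1, true)) (choice_clause N m true);
      Propagated None (choice_clause N m false)] (k' - m)
  else Some (Decided (0, false)).
Proof.
case: k => //= k; rewrite onth_cat size_t_decisions; case: ifP => // km.
by rewrite onth_map onthE (nth_map 0) ?size_iota //= nth_iota.
Qed.

(** The clauses at hand when [W_m] is to be learned: the input, which includes [W_N], and the [W_j]
    learned before. *)
Definition short_matrix N m (M : cnf) := forall C, C \in M <->
  (exists i b, i < N /\ C = choice_clause N i b) \/
  (exists2 j, m < j <= N & C = wide_clause N j).

(** * Unit clauses along the short trail *)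

Lemma unit_short1 N m : m < N ->
  unit_under (block_prefix N) (u_t_literals N m) (wide_clause N m.+1)
    (Some (N.+1 + m, false)).
Proof.
move=> mN; apply: unit_underI => [|l|l]; first by rewrite existentialE /tvar /=; lia.
- by rewrite mem_wide_clause mem_u_t_literals;
  case: l => v []; rewrite !xpair_eqE /=; lia.
- rewrite mem_wide_clause mem_u_t_literals inE;
  case: l => v []; rewrite /neg !xpair_eqE /=; lia.
Qed.

Lemma unit_short2 N m : m < N ->
  unit_under (block_prefix N) (rcons (u_t_literals N m) (N.+1 + m, false))
    (choice_clause N m true) (Some (m.+1, true)).
Proof.
move=> mN; apply: unit_underI => [|l|l]; first by rewrite existentialE /xvar /=; lia.
- by rewrite mem_rcons [X in _ -> ~~ X]inE mem_u_t_literals !inE;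
  case: l => v []; rewrite !xpair_eqE /=; lia.
- by rewrite mem_rcons [X in _ && ~~ X]inE mem_u_t_literals !inE;
  case: l => v []; rewrite /neg !xpair_eqE /=; lia.
Qed.

Lemma unit_short3 N m : m < N -> unit_under (block_prefix N)
    (u_t_literals N m ++ [:: (N.+1 + m, false); (m.+1, true)])
    (choice_clause N m false) None.
Proof.
move=> mN; apply: unit_underI => // l.
- by rewrite mem_cat mem_u_t_literals !inE;
  case: l => v []; rewrite !xpair_eqE /=; lia.
- by rewrite mem_cat mem_u_t_literals in_nil !inE;
  case: l => v []; rewrite /neg !xpair_eqE /=; lia.
Qed.

Lemma short_trail_is_trail N m Phi : m < N -> qprefix Phi = block_prefix N ->
  short_matrix N m (qmatrix Phi) -> is_trail ASS_R_ORD Phi (short_trail N m).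
Proof.
move=> mN QE ME; split.
  rewrite -(take_size (short_trail N m)) size_short_trail.
  rewrite (_ : m.+4 = m.+1 + 3); last lia.
  rewrite take_short_trail.
  rewrite -cat1s !assigned_cat assigned_t_decisions /= map_cat /= -map_comp.
  rewrite (_ : map _ _ = iota N.+1 m); last by rewrite -[in RHS](addn0 N.+1) iotaDl.
  by rewrite mem_cat cat_uniq iota_uniq /= !inE !mem_iota; lia.
move=> k e; rewrite onth_short_trail; case: k => [[<-]|k].
  by rewrite QE mem_block_prefix; split=> //; rewrite /ASS_R_ORD QE existentialE.
case: ltnP => km; first case=> <-.
  rewrite QE mem_block_prefix; split; first by rewrite /tvar /=; lia.
  by move=> _ u; rewrite QE universalE => /eqP -> _; rewrite inE.
rewrite QE -(subnKC km) addKn.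
case: (k - m) => [[<-]|[[<-]|[[<-]|j]]]; last by rewrite /= onth0n.
- rewrite addn0 assigned_short_trail //; split=> //; last exact: unit_short1.
  by apply/ME; right; exists m.+1; rewrite ?ltnSn.
- rewrite addn1 assigned_short_trail2; split=> //; last exact: unit_short2.
  by apply/ME; left; exists m, true.
- rewrite addn2 assigned_short_trail3; split=> //; first last.
  + by rewrite size_short_trail.
  + exact: unit_short3.
  by apply/ME; left; exists m, false.
Qed.

(** For [i < q] the choice clauses are satisfied by [t_i]; for the others [x_i] and [t_i] are both
    unassigned. From [q < m < j], the clause [W_j] still has [~t_q] and [~t_(q+1)] open. *)
Lemma no_unit_short N m q C x : q < m -> m < N ->
  (exists i b, i < N /\ C = choice_clause N i b) \/
  (exists2 j, m < j <= N & C = wide_clause N j) ->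
  ~ unit_under (block_prefix N) (u_t_literals N q) C x.
Proof.
move=> qm mN [[i [b [iN ->]]]|[j mj ->]].
  have [iq|qi] := ltnP i q.
    apply: (@not_unit_under_sat _ _ _ _ (N.+1 + i, true));
      first by rewrite !inE eqxx !orbT.
    by rewrite mem_u_t_literals /=; lia.
  apply: (@not_unit_under _ _ _ _ (i.+1, b) (N.+1 + i, true));
    rewrite ?mem_u_t_literals ?inE ?eqxx ?orbT ?xpair_eqE //=; lia.
by apply: (@not_unit_under _ _ _ _ (N.+1 + q, false) (N.+1 + q.+1, false));
  rewrite ?mem_u_t_literals ?mem_wide_clause ?xpair_eqE //=; lia.
Qed.

(** From [0 < m < j], every [W_j] at hand has literals on both [t_0] and [t_1]. *)
Lemma no_initial_unit N m C x : 0 < m ->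
  (exists i b, i < N /\ C = choice_clause N i b) \/
  (exists2 j, m < j <= N & C = wide_clause N j) ->
  ~ unit_under (block_prefix N) [::] C x.
Proof.
move=> m0 [[i [b [iN ->]]]|[j mj ->]].
  apply: (@not_unit_under _ _ _ _ (i.+1, b) (N.+1 + i, true));
    rewrite ?inE ?eqxx ?orbT ?xpair_eqE //=; lia.
by apply: (@not_unit_under _ _ _ _ (N.+1, false) (N.+2, false));
  rewrite ?mem_wide_clause ?xpair_eqE //=; lia.
Qed.

(** Nothing is unit while the [t_i] are decided. At the two propagations a conflict must be
    excluded: choice clauses for [i < m] are satisfied, the others have [x_i] open, and [W_j] has
    [~t_m] first open and then satisfied. *)
Lemma short_trail_natural N m Phi : m < N -> qprefix Phi = block_prefix N ->
  short_matrix N m (qmatrix Phi) -> natural_from Phi (short_trail N m) 1.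
Proof.
move=> mN QE ME [|k] // /andP[_ kT] nc; rewrite /natural_at QE => exU.
have [km|mk] := ltnP k m.
  move: exU; rewrite assigned_short_trail ?(ltnW km) // => -[C [x [/ME CM]]].
  by case/(no_unit_short km mN CM).
rewrite -(subnKC mk) -addSn in kT nc {exU} *; rewrite addSn onth_short_trail.
move: (k - m) kT nc => j {k mk}; rewrite size_short_trail ltnNge leq_addr addKn -addSn.
case: j => [|[|[|j]]] kT nc.
- rewrite !addn0 assigned_short_trail //.
  exists (wide_clause N m.+1), (Some (N.+1 + m, false)); split=> //.
  + by apply/ME; right; exists m.+1; rewrite ?ltnSn.
  + exact: unit_short1.
  case=> C /ME[[i [b [iN ->]]]|[j mj ->]] U; exfalso; move: U.
    have [im|mi] := ltnP i m.
      apply: (@not_unit_under_sat _ _ _ _ (N.+1 + i, true));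
        first by rewrite !inE eqxx !orbT.
      by rewrite mem_u_t_literals /=; lia.
    apply: (@not_conflict_under _ _ _ (i.+1, b));
      rewrite ?mem_u_t_literals ?inE ?eqxx ?orbT ?xpair_eqE //=; lia.
  by apply: (@not_conflict_under _ _ _ (N.+1 + m, false));
    rewrite ?mem_u_t_literals ?mem_wide_clause ?xpair_eqE //=; lia.
- rewrite !addn1 assigned_short_trail2.
  exists (choice_clause N m true), (Some (m.+1, true)); split=> //.
  + by apply/ME; left; exists m, true.
  + exact: unit_short2.
  case=> C /ME[[i [b [iN ->]]]|[j mj ->]] U; exfalso; move: U.
    have [im|mi] := ltnP i m.
      apply: (@not_unit_under_sat _ _ _ _ (N.+1 + i, true));
        first by rewrite !inE eqxx !orbT.
      by rewrite mem_rcons inE mem_u_t_literals /=; lia.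
    apply: (@not_conflict_under _ _ _ (i.+1, b)) => //; first by rewrite !inE eqxx orbT.
    by rewrite mem_rcons inE mem_u_t_literals !xpair_eqE /=; lia.
  apply: (@not_unit_under_sat _ _ _ _ (N.+1 + m, false));
    last by rewrite mem_rcons mem_head.
  by rewrite mem_wide_clause /=; lia.
- rewrite !addn2 assigned_short_trail3.
  exists (choice_clause N m false), None; split=> //; last exact: unit_short3.
  by apply/ME; left; exists m, false.
- move: nc; rewrite take_oversize ?size_short_trail; last lia.
  by rewrite /has_conflict /= has_cat /= orbT.
Qed.

Lemma short_trail_natural0 N m Phi : 0 < m -> m < N -> qprefix Phi = block_prefix N ->
  short_matrix N m (qmatrix Phi) -> natural Phi (short_trail N m).
Proof.
move=> m0 mN QE ME [|k] kT nc; last exact: (short_trail_natural mN QE ME).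
rewrite /natural_at QE take0 => -[C [x [/ME CM]]].
by case/(no_initial_unit m0 CM).
Qed.

Lemma concl_short_derivation N m : m < N ->
  concl (block_prefix N) (short_derivation N m) =i short_clause N m.
Proof.
move=> mN; set Q := block_prefix N.
have tm : tvar N (N.+1 + m) by rewrite /tvar; lia.
have rc b : red Q (choice_clause N m b) =i choice_clause N m b.
  by apply: (@red_tvar N _ (N.+1 + m, true)); rewrite // !inE eqxx !orbT.
have rw j : 0 < j <= N -> red Q (wide_clause N j) =i wide_clause N j.
  move=> jN; apply: (@red_tvar N _ (N.+1, false));
    rewrite ?mem_wide_clause /tvar /=; lia.
have E1 : red Q (resolvent (m.+1, true) (red Q (choice_clause N m false))
    (red Q (choice_clause N m true))) =i [:: (0, true); (N.+1 + m, true)].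
  move=> l; rewrite (@red_tvar N _ (N.+1 + m, true)) //;
    rewrite ?mem_resolvent ?rc ?inE; last first.
    by rewrite /neg !xpair_eqE /=; lia.
  by case: l => v []; rewrite /neg !xpair_eqE /=; lia.
have E2 : resolvent (N.+1 + m, false)
    (red Q (resolvent (m.+1, true) (red Q (choice_clause N m false))
    (red Q (choice_clause N m true)))) (red Q (wide_clause N m.+1)) =i wide_clause N m.
  move=> l; rewrite mem_resolvent E1 rw // !mem_wide_clause !inE.
  by case: l => v []; rewrite /neg !xpair_eqE /=; lia.
(* The final reduction matters only for [W_0], which consists of [u] alone and becomes empty. *)
move=> l; rewrite /= (eq_red N E2); case: m mN {E1 E2 rc tm} => [|m] mN.
  by rewrite mem_red !inE /=; case: eqP => [->|].
by rewrite rw //=; lia.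
Qed.

Lemma short_round_learned N m : m < N -> learned (block_prefix N) (short_round N m).
Proof.
move=> mN; split=> [|l]; last by rewrite concl_short_derivation.
have E : rev (short_trail N m) =
    [:: Propagated None (choice_clause N m false),
        Propagated (Some (m.+1, true)) (choice_clause N m true),
        Propagated (Some (N.+1 + m, false)) (wide_clause N m.+1)
      & rev (Decided (0, false) :: t_decisions N m)].
  exact: (rev_cat (Decided (0, false) :: t_decisions N m)).
(* Position 0 is the conflict clause; positions 1 and 2 follow the resolutions over [x_m] and
   [t_m]. *)
exists 2; rewrite /learnable_derivations -[rtrail _]/(short_trail N m) E.
set p1 := ((m.+1, true), choice_clause N m true).
set p2 := ((N.+1 + m, false), wide_clause N m.+1).
set d0 := Red _; set step := learn_step (block_prefix N).
rewrite -[LHS]/(Some (step (step d0 p1) p2)) /step.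
have -> : learn_step (block_prefix N) d0 p1 = Red (Res p1.1 d0 (Red (Ax p1.2))).
  by rewrite /learn_step ifT // /= mem_red !inE /neg !xpair_eqE /=; lia.
rewrite /learn_step ifT // [concl _ _]/= (@red_tvar N _ (N.+1 + m, true));
  rewrite ?mem_resolvent.
- by rewrite !mem_red !inE /neg !xpair_eqE /tvar /=; lia.
- by rewrite !mem_red !inE /neg !xpair_eqE /tvar /=; lia.
- by rewrite /tvar /=; lia.
Qed.

Lemma short_refutation_matrix N k : k < N -> short_matrix N (N - k.+1)
  (qmatrix (extend (choice_formula N)
     [seq rclause R | R <- take k (short_refutation N)])).
Proof.
move=> kN C; rewrite /short_refutation -map_take take_iota (minn_idPl (ltnW kN)).
rewrite -map_comp; set L := map _ _.
have -> : (C \in qmatrix (extend (choice_formula N) L)) =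
    (C \in qmatrix (choice_formula N)) || (C \in L) by rewrite mem_cat.
split=> [/orP[/choice_formulaP[|->]|/mapP[i]]|[iC|[j kj ->]]].
- by left.
- by right; exists N => //; lia.
- rewrite mem_iota => ik ->; right; exists (N - i.+1); first lia.
  by rewrite /= /short_clause; case E: (N - i.+1) => //; lia.
- by apply/orP; left; apply/choice_formulaP; left.
apply/orP; have [->|jN] := eqVneq j N; first by left; apply/choice_formulaP; right.
(* The round that learned [W_j]. *)
right; apply/mapP; exists (N - j.+1); first by rewrite mem_iota; lia.
rewrite /= (_ : N - (N - j.+1).+1 = j); last lia.
by case: j kj {jN}.
Qed.

Lemma short_refutation_correct N : 1 < N ->
  is_refutation ASS_R_ORD (choice_formula N) (short_refutation N).
Proof.
move=> N1; split.
  exists [seq short_round N (N - k.+1) | k <- iota 0 N.-1], (short_round N 0).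
  have EN : iota 0 N = rcons (iota 0 N.-1) N.-1.
    by case: (N) N1 => // n _; rewrite -[n.+1]addn1 iotaD cats1 addn1.
  by split=> //; rewrite /short_refutation EN map_rcons (prednK (ltnW N1)) subnn.
move=> k R; rewrite onth_map onthE; have [kN|Nk] := ltnP k N; last first.
  by rewrite nth_default // size_map size_iota.
rewrite (nth_map 0) ?size_iota // nth_iota //= add0n => -[<-] {R}.
have ME := short_refutation_matrix kN.
set Phi := extend _ _ in ME *; have mN : N - k.+1 < N by lia.
split.
- exact: short_trail_is_trail ME.
- by rewrite /has_conflict /= has_cat /= orbT.
- exact: short_round_learned.
case: k kN mN @Phi ME => [|k] kN mN Phi ME.
  by apply: short_trail_natural0 ME => //; lia.
exists (short_round N (N - k.+1)).
  by rewrite onth_map onthE (nth_map 0) ?size_iota ?nth_iota //=; lia.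
(* Backtrack to just after the decision [~u], with which every round begins. *)
exists 1; split=> //; first by rewrite /= !take0.
by apply: (short_trail_natural mN) ME.
Qed.

Lemma short_refutation_size N : proof_size (short_refutation N) <= N * (N + 3).
Proof.
rewrite /proof_size big_map -[X in X * _](size_iota 0 N) -sum1_size big_distrl.
rewrite !big_seq; apply: leq_sum => k; rewrite mem_iota => kN.
rewrite -[size _]/(size (short_trail N (N - k.+1))) size_short_trail.
by rewrite -[X in _ < X]/(1 * (N + 3)); lia.
Qed.

(** * Sizes *)

Lemma polynomial_bound a b : exists k, forall n, a * n.+2 ^ b <= n ^ k + k.
Proof.
(* For [n <= 1] the additive term [a * 3 ^ b] is enough; for [n >= 2], use [a <= n ^ a] and
   [n + 2 <= n ^ 2]. *)
exists (a + 2 * b + a * 3 ^ b) => n; have [n1|n1] := leqP n 1.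
  apply: leq_trans (leq_addl _ _); apply: leq_trans (leq_addl _ _).
  by apply: leq_mul => //; case: b => // b; rewrite leq_exp2r.
apply: leq_trans (leq_addr _ _).
apply: (@leq_trans (n ^ (a + 2 * b))); last by rewrite leq_exp2l ?leq_addr.
rewrite expnD expnM; apply: leq_mul.
  by apply: leq_trans (ltnW (ltn_expl a n1)) _.
by case: b => // b; rewrite leq_exp2r //; nia.
Qed.

Lemma size_flatten_leq (A : Type) (f : A -> word) (c : nat) (s : seq A) :
  all (fun x => size (f x) <= c) s -> size (flatten (map f s)) <= size s * c.
Proof.
elim: s => //= x s IH /andP[xc /IH H]; rewrite size_cat mulSn; exact: leq_add.
Qed.

Lemma size_enc_seq (A : Type) (f : A -> word) c (s : seq A) :
  all (fun x => size (f x) <= c) s -> size (enc_seq f s) <= size s * c + 4.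
Proof.
by move=> /size_flatten_leq H; rewrite /enc_seq /bracket /= size_cat /=; lia.
Qed.

Lemma size_nat_bits n : size (nat_bits n) <= n.
Proof.
rewrite /nat_bits -{2}(bin_of_natK n); case: (bin_of_nat n) => //= p.
have pos q : 0 < nat_of_pos q by elim: q => //= q; rewrite NatTrec.doubleE; lia.
by elim: p => //= p IH; rewrite NatTrec.doubleE; have := pos p; lia.
Qed.

Lemma size_enc_nat n : size (enc_nat n) <= 2 * n + 4.
Proof.
have := @size_enc_seq _ enc_bool 2 (nat_bits n); rewrite -/(enc_nat n) => H.
apply: leq_trans (H _) _; first by apply/allP.
by have := size_nat_bits n; lia.
Qed.

Lemma size_enc_clause N (C : clause) : (forall l, l \in C -> l.1 <= N + N) ->
  size (enc_clause C) <= size C * (4 * N + 6) + 4.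
Proof.
move=> CN; apply: size_enc_seq; apply/allP => -[v c] /CN vN.
rewrite (_ : size _ = size (enc_nat v) + 2); last exact: size_cat.
by have := size_enc_nat v; rewrite /= in vN; lia.
Qed.

Lemma size_enc_block N (b : quantifier * seq var) :
  (forall v, v \in b.2 -> v <= N + N) ->
  size (enc_block b) <= size b.2 * (4 * N + 4) + 6.
Proof.
move=> bN; have H : size (enc_seq enc_nat b.2) <= size b.2 * (4 * N + 4) + 4.
  apply: size_enc_seq; apply/allP => v /bN vN; have := size_enc_nat v; lia.
by rewrite /enc_block size_cat [size (enc_bool _)]/=; lia.
Qed.

Lemma choice_formula_size N : qcnf_size (choice_formula N) <= 100 * N.+1 ^ 3.
Proof.
have H1 : size (enc_seq enc_block (block_prefix N)) <= 3 * (N.+1 * (4 * N + 4) + 6) + 4.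
  apply: size_enc_seq; apply/allP => b; rewrite !inE.
  case/or3P => /eqP ->; apply: leq_trans (size_enc_block (N := N) _) _ => [v|];
    rewrite ?mem_iota ?inE ?size_iota /=; nia.
(* There are [2 * N + 1] clauses; [N + 3] bounds both clause lengths, [3] and [N + 1], and
   [4 * N + 6] bounds the code of a literal. *)
have H2 : size (enc_seq enc_clause (qmatrix (choice_formula N))) <=
    (2 * N + 1) * ((N + 3) * (4 * N + 6) + 4) + 4.
  apply: leq_trans (@size_enc_seq _ _ ((N + 3) * (4 * N + 6) + 4) _ _) _; last first.
    by rewrite /= !size_cat !size_map size_iota /=; nia.
  apply/allP => C /choice_formulaP[[i [b [iN ->]]]| ->].
    apply: leq_trans (size_enc_clause (N := N) _) _ => [l|].
      by rewrite !inE => /or3P[] /eqP -> /=; lia.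
    by rewrite /=; nia.
  apply: leq_trans (size_enc_clause (N := N) _) _ => [l|].
    by rewrite mem_wide_clause => /orP[/eqP -> //|]; lia.
  by rewrite /= size_map size_iota; nia.
rewrite /qcnf_size size_cat; apply: leq_trans (leq_add H1 H2) _.
by rewrite !expnS expn0 muln1; nia.
Qed.

(** Refutation sizes are to be bounded in terms of the formula size, not of [N]; the block of the
    [x_i] alone provides [N] symbols. *)
Lemma choice_formula_size_ge N : N <= qcnf_size (choice_formula N).
Proof.
rewrite /qcnf_size /enc_qcnf /enc_seq /bracket /= !size_cat /= !size_cat /=.
have H : forall s, size s <= size (flatten (map enc_nat s)).
  by elim=> //= x s IH; rewrite !size_cat /=; lia.
by have := H (iota 1 N); rewrite size_iota; lia.
Qed.

Theorem theorem8p6 :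
  p_simulates (QCDCL_RED ASS_R_ORD) (QCDCL_RED LEV_ORD) /\
  exists F : nat -> qcnf,
    [/\ forall n, qcnf_wf (F n) /\ ~~ qcnf_true (F n),
        polynomial_size F,
        has_polynomial_refutations ASS_R_ORD F
      & requires_exponential_refutations LEV_ORD F].
Proof.
split; first exact: ASS_R_ORD_p_simulates_LEV_ORD.
(* The shift provides [1 < N] for the short refutation and [0 < N] for the lower bound. *)
exists (fun n => choice_formula n.+2); split.
- by move=> n; split; [exact: choice_formula_wf|exact: choice_formula_false].
(* With [N = n + 2], the bound [100 * (N + 1) ^ 3] is absorbed by [N + 1 <= 2 * (n + 2)]. *)
- have [k Hk] := polynomial_bound (100 * 2 ^ 3) 3; exists k => n.
  apply: leq_trans (Hk n); apply: leq_trans (choice_formula_size _) _.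
  by rewrite -mulnA -expnMn leq_mul2l leq_exp2r //; lia.
(* If [s] is the formula size, then [N <= s] gives [N * (N + 3) <= 3 * (s + 2) ^ 2]. *)
- have [k Hk] := polynomial_bound 3 2; exists k => n.
  exists (short_refutation n.+2); first exact: short_refutation_correct.
  apply: leq_trans (Hk _); apply: leq_trans (short_refutation_size _) _.
  by have := choice_formula_size_ge n.+2; rewrite !expnS expn0 muln1; nia.
- exists 0 => n pi rpi; apply: leq_trans (LEV_ORD_lower_bound _ rpi) => //.
  by rewrite divn1 leq_exp2l //; lia.
Qed.
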